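(* The intuitionistic tense logic $\mathrm{IK}_t$ can be axiomatised by adding to the axioms of intuitionistic logic the schemes $G(A\to B)\to(GA\to GB)$, $H(A\to B)\to(HA\to HB)$, $G(A\to B)\to(FA\to FB)$, $H(A\to B)\to(PA\to PB)$, $FHA\to A$, $PGA\to A$, $A\to HFA$, $A\to GPA$, $F(A\to B)\to(GA\to FB)$, $P(A\to B)\to(HA\to PB)$, together with the rules modus ponens, (RH) from $A$ infer $HA$, and (RG) from $A$ infer $GA$. That is, this system proves exactly the same formulas as $\mathrm{IK}_t$.
   Context: Formulas are built from a countably infinite set of propositional variables with the connectives $\neg,\vee,\wedge,\to$ and the unary connectives $F,G,P,H$. $\mathrm{IK}_t$ (Ewald) is the Hilbert-style system whose axioms are all axioms of intuitionistic logic together with all instances of the schemes (2) $G(A\to B)\to(GA\to GB)$; (2$'$) $H(A\to B)\to(HA\to HB)$; (3) $G(A\wedge B)\leftrightarrow GA\wedge GB$; (3$'$) $H(A\wedge B)\leftrightarrow HA\wedge HB$; (4) $F(A\vee B)\leftrightarrow FA\vee FB$; (4$'$) $P(A\vee B)\leftrightarrow PA\vee PB$; (5) $G(A\to B)\to(FA\to FB)$; (5$'$) $H(A\to B)\to(PA\to PB)$; (6) $GA\wedge FB\to F(A\wedge B)$; (6$'$) $HA\wedge PB\to P(A\wedge B)$; (7) $G\neg A\to\neg FA$; (7$'$) $H\neg A\to\neg PA$; (8) $FHA\to A$; (8$'$) $PGA\to A$; (9) $A\to HFA$; (9$'$) $A\to GPA$; (10) $(FA\to GB)\to G(A\to B)$;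 (10$'$) $(PA\to HB)\to H(A\to B)$; (11) $F(A\to B)\to(GA\to FB)$; (11$'$) $P(A\to B)\to(HA\to PB)$; and whose rules are modus ponens, (RH) from $A$ infer $HA$, and (RG) from $A$ infer $GA$. *)

(* Defs.v *)
Inductive formula : Type :=
| Var : nat -> formula
| Neg : formula -> formula
| Or  : formula -> formula -> formula
| And : formula -> formula -> formula
| Imp : formula -> formula -> formula
| Fut : formula -> formula
| Glo : formula -> formula
| Pst : formula -> formula
| His : formula -> formula.

Definition Iff (A B : formula) : formula := And (Imp A B) (Imp B A).

Declare Scope tense_scope.
Delimit Scope tense_scope with tense.
Bind Scope tense_scope with formula.

Notation "¬ A" := (Neg A) (at level 75, right associativity) : tense_scope.
Notation "A ∧ B" := (And A B) (at level 80, right associativity) : tense_scope.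
Notation "A ∨ B" := (Or A B) (at level 85, right associativity) : tense_scope.
Notation "A ⊃ B" := (Imp A B) (at level 90, right associativity) : tense_scope.
Notation "A ↔ B" := (Iff A B) (at level 95, no associativity) : tense_scope.
Notation "'𝐅' A" := (Fut A) (at level 30, right associativity) : tense_scope.
Notation "'𝐆' A" := (Glo A) (at level 30, right associativity) : tense_scope.
Notation "'𝐏' A" := (Pst A) (at level 30, right associativity) : tense_scope.
Notation "'𝐇' A" := (His A) (at level 30, right associativity) : tense_scope.

Local Open Scope tense_scope.

(* Kleene's axiom schemes for intuitionistic propositional logic with primitive
   negation, instantiated with arbitrary tense formulas. *)
Inductive int_axiom : formula -> Prop :=
| int_K A B : int_axiom (A ⊃ B ⊃ A)
| int_S A B C : int_axiom ((A ⊃ B ⊃ C) ⊃ (A ⊃ B) ⊃ A ⊃ C)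
| int_and_l A B : int_axiom (A ∧ B ⊃ A)
| int_and_r A B : int_axiom (A ∧ B ⊃ B)
| int_and_i A B : int_axiom (A ⊃ B ⊃ A ∧ B)
| int_or_l A B : int_axiom (A ⊃ A ∨ B)
| int_or_r A B : int_axiom (B ⊃ A ∨ B)
| int_or_e A B C : int_axiom ((A ⊃ C) ⊃ (B ⊃ C) ⊃ A ∨ B ⊃ C)
| int_neg_i A B : int_axiom ((A ⊃ B) ⊃ (A ⊃ ¬ B) ⊃ ¬ A)
| int_neg_e A B : int_axiom (¬ A ⊃ A ⊃ B).

Inductive IKt_axiom : formula -> Prop :=
| IKt_int A : int_axiom A -> IKt_axiom A
| IKt_2   A B : IKt_axiom (𝐆 (A ⊃ B) ⊃ (𝐆 A ⊃ 𝐆 B))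
| IKt_2'  A B : IKt_axiom (𝐇 (A ⊃ B) ⊃ (𝐇 A ⊃ 𝐇 B))
| IKt_3   A B : IKt_axiom (𝐆 (A ∧ B) ↔ (𝐆 A ∧ 𝐆 B))
| IKt_3'  A B : IKt_axiom (𝐇 (A ∧ B) ↔ (𝐇 A ∧ 𝐇 B))
| IKt_4   A B : IKt_axiom (𝐅 (A ∨ B) ↔ (𝐅 A ∨ 𝐅 B))
| IKt_4'  A B : IKt_axiom (𝐏 (A ∨ B) ↔ (𝐏 A ∨ 𝐏 B))
| IKt_5   A B : IKt_axiom (𝐆 (A ⊃ B) ⊃ (𝐅 A ⊃ 𝐅 B))
| IKt_5'  A B : IKt_axiom (𝐇 (A ⊃ B) ⊃ (𝐏 A ⊃ 𝐏 B))
| IKt_6   A B : IKt_axiom ((𝐆 A ∧ 𝐅 B) ⊃ 𝐅 (A ∧ B))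
| IKt_6'  A B : IKt_axiom ((𝐇 A ∧ 𝐏 B) ⊃ 𝐏 (A ∧ B))
| IKt_7   A   : IKt_axiom (𝐆 (¬ A) ⊃ ¬ (𝐅 A))
| IKt_7'  A   : IKt_axiom (𝐇 (¬ A) ⊃ ¬ (𝐏 A))
| IKt_8   A   : IKt_axiom (𝐅 𝐇 A ⊃ A)
| IKt_8'  A   : IKt_axiom (𝐏 𝐆 A ⊃ A)
| IKt_9   A   : IKt_axiom (A ⊃ 𝐇 𝐅 A)
| IKt_9'  A   : IKt_axiom (A ⊃ 𝐆 𝐏 A)
| IKt_10  A B : IKt_axiom ((𝐅 A ⊃ 𝐆 B) ⊃ 𝐆 (A ⊃ B))
| IKt_10' A B : IKt_axiom ((𝐏 A ⊃ 𝐇 B) ⊃ 𝐇 (A ⊃ B))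
| IKt_11  A B : IKt_axiom (𝐅 (A ⊃ B) ⊃ (𝐆 A ⊃ 𝐅 B))
| IKt_11' A B : IKt_axiom (𝐏 (A ⊃ B) ⊃ (𝐇 A ⊃ 𝐏 B)).

Inductive IKt_reduced_axiom : formula -> Prop :=
| IKtr_int A : int_axiom A -> IKt_reduced_axiom A
| IKtr_2   A B : IKt_reduced_axiom (𝐆 (A ⊃ B) ⊃ (𝐆 A ⊃ 𝐆 B))
| IKtr_2'  A B : IKt_reduced_axiom (𝐇 (A ⊃ B) ⊃ (𝐇 A ⊃ 𝐇 B))
| IKtr_5   A B : IKt_reduced_axiom (𝐆 (A ⊃ B) ⊃ (𝐅 A ⊃ 𝐅 B))
| IKtr_5'  A B : IKt_reduced_axiom (𝐇 (A ⊃ B) ⊃ (𝐏 A ⊃ 𝐏 B))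
| IKtr_8   A   : IKt_reduced_axiom (𝐅 𝐇 A ⊃ A)
| IKtr_8'  A   : IKt_reduced_axiom (𝐏 𝐆 A ⊃ A)
| IKtr_9   A   : IKt_reduced_axiom (A ⊃ 𝐇 𝐅 A)
| IKtr_9'  A   : IKt_reduced_axiom (A ⊃ 𝐆 𝐏 A)
| IKtr_11  A B : IKt_reduced_axiom (𝐅 (A ⊃ B) ⊃ (𝐆 A ⊃ 𝐅 B))
| IKtr_11' A B : IKt_reduced_axiom (𝐏 (A ⊃ B) ⊃ (𝐇 A ⊃ 𝐏 B)).

(* RH and RG apply to theorems only: there is no context of hypotheses. *)
Inductive provable (Ax : formula -> Prop) : formula -> Prop :=
| pr_ax A : Ax A -> provable Ax A
| pr_MP A B : provable Ax (A ⊃ B) -> provable Ax A -> provable Ax B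
| pr_RH A : provable Ax A -> provable Ax (𝐇 A)
| pr_RG A : provable Ax A -> provable Ax (𝐆 A).

(* Main.v *)
(** [F] is left adjoint to [H], and [P] to [G], by schemes (8) and (9). Hence [F]
    preserves disjunctions, which is (4), and [F] of a contradiction is
    contradictory, which with (5) gives (7). For (10), by [P -| G] it suffices to
    derive [P (FA -> GB) -> (A -> B)]: by (11'), [P (FA -> GB)] gives
    [HFA -> PGB], while [A -> HFA] and [PGB -> B]. The primed schemes follow
    because the reduced system is invariant under exchanging past and future. *)

Require Import Defs.

Local Open Scope tense_scope.

(** * Derived rules of intuitionistic propositional logic *)

Section Intuitionistic.

Variable Ax : formula -> Prop.
Hypothesis Ax_int : forall A, int_axiom A -> Ax A.

Local Notation "⊢ A" := (provable Ax A%tense) (at level 98).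

Lemma provable_int A : int_axiom A -> ⊢ A.
Proof. intros H; apply pr_ax, Ax_int, H. Qed.

Lemma provable_weaken A B : ⊢ A -> ⊢ B ⊃ A.
Proof. apply pr_MP, provable_int, int_K. Qed.

(** Scheme [int_S] read as modus ponens under a hypothesis [C]; with [provable_weaken] it stands in
    for a deduction theorem. *)
Lemma provable_imp_MP C A B : ⊢ C ⊃ A ⊃ B -> ⊢ C ⊃ A -> ⊢ C ⊃ B.
Proof. intros H; apply pr_MP; revert H; apply pr_MP, provable_int, int_S. Qed.

Lemma provable_imp_trans A B C : ⊢ A ⊃ B -> ⊢ B ⊃ C -> ⊢ A ⊃ C.
Proof. intros HAB HBC; eapply provable_imp_MP; eauto using provable_weaken. Qed.

Lemma provable_imp_refl A : ⊢ A ⊃ A.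
Proof.
apply provable_imp_MP with (A ⊃ A); apply provable_int, int_K.
Qed.

Lemma provable_and A B : ⊢ A -> ⊢ B -> ⊢ A ∧ B.
Proof. intros HA; apply pr_MP; revert HA; apply pr_MP, provable_int, int_and_i. Qed.

Lemma provable_imp_and C A B : ⊢ C ⊃ A -> ⊢ C ⊃ B -> ⊢ C ⊃ A ∧ B.
Proof.
intros HA; apply provable_imp_MP, (provable_imp_trans _ _ _ HA).
apply provable_int, int_and_i.
Qed.

Lemma provable_or_imp A B C : ⊢ A ⊃ C -> ⊢ B ⊃ C -> ⊢ A ∨ B ⊃ C.
Proof. intros HA; apply pr_MP; revert HA; apply pr_MP, provable_int, int_or_e. Qed.

Lemma provable_and_imp A B C : ⊢ A ⊃ B ⊃ C -> ⊢ A ∧ B ⊃ C.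
Proof.
intros H; apply provable_imp_MP with B; [|apply provable_int, int_and_r].
apply provable_imp_trans with A; [apply provable_int, int_and_l | exact H].
Qed.

Lemma provable_curry A B C : ⊢ A ∧ B ⊃ C -> ⊢ A ⊃ B ⊃ C.
Proof.
intros H; apply provable_imp_trans with (B ⊃ A ∧ B).
- apply provable_int, int_and_i.
- eapply pr_MP; [apply provable_int, int_S | apply provable_weaken, H].
Qed.

(** Serves to adjust the two ends of an instance of (5) or (11') by the unit (9) or the counits (8),
    (8'). *)
Lemma provable_imp_dimap C A A' B B' :
  ⊢ A' ⊃ A -> ⊢ B ⊃ B' -> ⊢ C ⊃ A ⊃ B -> ⊢ C ⊃ A' ⊃ B'.
Proof.
intros HA HB H; apply provable_curry.
apply provable_imp_trans with B; [|exact HB].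
apply provable_imp_MP with A.
- eapply provable_imp_trans; [apply provable_int, int_and_l | exact H].
- eapply provable_imp_trans; [apply provable_int, int_and_r | exact HA].
Qed.

(** Negation is primitive and there is no falsum, so [A] is refuted by deriving its own negation
    from it: [int_neg_i] with [B] taken to be [A]. *)
Lemma provable_imp_neg C A : ⊢ C ⊃ A ⊃ ¬ A -> ⊢ C ⊃ ¬ A.
Proof.
intros H; apply provable_imp_trans with (A ⊃ ¬ A); [exact H|].
eapply pr_MP; [apply provable_int, int_neg_i | apply provable_imp_refl].
Qed.

End Intuitionistic.

(** * Symmetry between past and future *)

Fixpoint mirror (A : formula) : formula :=
  match A with
  | Var n => Var n
  | Neg A => Neg (mirror A)
  | Or A B => Or (mirror A) (mirror B)
  | And A B => And (mirror A) (mirror B)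
  | Imp A B => Imp (mirror A) (mirror B)
  | Fut A => Pst (mirror A)
  | Glo A => His (mirror A)
  | Pst A => Fut (mirror A)
  | His A => Glo (mirror A)
  end.

Lemma mirrorK A : mirror (mirror A) = A.
Proof. induction A; simpl; congruence. Qed.

Lemma mirror_int_axiom A : int_axiom A -> int_axiom (mirror A).
Proof. intros []; constructor. Qed.

Lemma mirror_reduced_axiom A : IKt_reduced_axiom A -> IKt_reduced_axiom (mirror A).
Proof. intros []; constructor; apply mirror_int_axiom; assumption. Qed.

Local Notation "⊢ A" := (provable IKt_reduced_axiom A%tense) (at level 98).

Lemma mirror_provable A : ⊢ A -> ⊢ mirror A.
Proof.
induction 1; simpl in *.
- apply pr_ax, mirror_reduced_axiom; assumption.
- eapply pr_MP; eassumption.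
- apply pr_RG; assumption.
- apply pr_RH; assumption.
Qed.

(** Since [mirror] is an involution, provability is also reflected; a primed scheme thus follows
    from its unprimed form. *)
Lemma reduced_mirror A : ⊢ mirror A -> ⊢ A.
Proof. intros H; rewrite <- (mirrorK A); apply mirror_provable, H. Qed.

(** * Monotonicity, adjunctions and the omitted schemes *)

Lemma reduced_G_mono A B : ⊢ A ⊃ B -> ⊢ 𝐆 A ⊃ 𝐆 B.
Proof. intros H; eapply pr_MP; [apply pr_ax, IKtr_2 | apply pr_RG, H]. Qed.

Lemma reduced_F_mono A B : ⊢ A ⊃ B -> ⊢ 𝐅 A ⊃ 𝐅 B.
Proof. intros H; eapply pr_MP; [apply pr_ax, IKtr_5 | apply pr_RG, H]. Qed.

Lemma reduced_H_mono A B : ⊢ A ⊃ B -> ⊢ 𝐇 A ⊃ 𝐇 B.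
Proof. intros H; eapply pr_MP; [apply pr_ax, IKtr_2' | apply pr_RH, H]. Qed.

Local Notation int := (provable_int _ IKtr_int _).
Local Notation trans := (provable_imp_trans _ IKtr_int).

Lemma reduced_F_adjoint A B : ⊢ A ⊃ 𝐇 B -> ⊢ 𝐅 A ⊃ B.
Proof.
intros H; apply trans with (𝐅 𝐇 B).
- apply reduced_F_mono, H.
- apply pr_ax, IKtr_8.
Qed.

Lemma reduced_G_adjoint A B : ⊢ 𝐏 A ⊃ B -> ⊢ A ⊃ 𝐆 B.
Proof.
intros H; apply trans with (𝐆 𝐏 A).
- apply pr_ax, IKtr_9'.
- apply reduced_G_mono, H.
Qed.

Lemma reduced_3 A B : ⊢ 𝐆 (A ∧ B) ↔ (𝐆 A ∧ 𝐆 B).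
Proof.
apply (provable_and _ IKtr_int).
- apply (provable_imp_and _ IKtr_int); apply reduced_G_mono, int; constructor.
(* The pairing map [B ⊃ A ∧ B], obtained from [A] under [𝐆], is applied to [𝐆 B] by (2); for (6) it
   is applied to [𝐅 B] by (5). *)
- apply (provable_and_imp _ IKtr_int), trans with (𝐆 (B ⊃ A ∧ B)).
  + apply reduced_G_mono, int, int_and_i.
  + apply pr_ax, IKtr_2.
Qed.

Lemma reduced_4 A B : ⊢ 𝐅 (A ∨ B) ↔ (𝐅 A ∨ 𝐅 B).
Proof.
apply (provable_and _ IKtr_int).
(* Transposing [𝐅] leaves a bare disjunction on the left, open to case analysis. *)
- apply reduced_F_adjoint, (provable_or_imp _ IKtr_int).
  + apply trans with (𝐇 𝐅 A); [apply pr_ax, IKtr_9|].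
    apply reduced_H_mono, int, int_or_l.
  + apply trans with (𝐇 𝐅 B); [apply pr_ax, IKtr_9|].
    apply reduced_H_mono, int, int_or_r.
- apply (provable_or_imp _ IKtr_int); apply reduced_F_mono, int; constructor.
Qed.

Lemma reduced_6 A B : ⊢ (𝐆 A ∧ 𝐅 B) ⊃ 𝐅 (A ∧ B).
Proof.
apply (provable_and_imp _ IKtr_int), trans with (𝐆 (B ⊃ A ∧ B)).
- apply reduced_G_mono, int, int_and_i.
- apply pr_ax, IKtr_5.
Qed.

(* [¬ A ⊃ A ⊃ 𝐇 B] holds for every [B]; here [B] is [¬ 𝐅 A]. *)
Lemma reduced_7 A : ⊢ 𝐆 (¬ A) ⊃ ¬ (𝐅 A).
Proof.
apply (provable_imp_neg _ IKtr_int).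
apply (provable_imp_dimap _ IKtr_int) with (𝐅 A) (𝐅 𝐇 (¬ 𝐅 A)).
- apply (provable_imp_refl _ IKtr_int).
- apply pr_ax, IKtr_8.
- apply trans with (𝐆 (A ⊃ 𝐇 (¬ 𝐅 A))).
  + apply reduced_G_mono, int, int_neg_e.
  + apply pr_ax, IKtr_5.
Qed.

Lemma reduced_10 A B : ⊢ (𝐅 A ⊃ 𝐆 B) ⊃ 𝐆 (A ⊃ B).
Proof.
apply reduced_G_adjoint.
apply (provable_imp_dimap _ IKtr_int) with (𝐇 𝐅 A) (𝐏 𝐆 B).
- apply pr_ax, IKtr_9.
- apply pr_ax, IKtr_8'.
- apply pr_ax, IKtr_11'.
Qed.

Lemma reduced_proves_IKt_axiom A : IKt_axiom A -> ⊢ A.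
Proof.
intros []; try (apply pr_ax; constructor; assumption).
- apply reduced_3.
- apply reduced_mirror; simpl; apply reduced_3.
- apply reduced_4.
- apply reduced_mirror; simpl; apply reduced_4.
- apply reduced_6.
- apply reduced_mirror; simpl; apply reduced_6.
- apply reduced_7.
- apply reduced_mirror; simpl; apply reduced_7.
- apply reduced_10.
- apply reduced_mirror; simpl; apply reduced_10.
Qed.

Lemma reduced_axiom_IKt A : IKt_reduced_axiom A -> IKt_axiom A.
Proof. intros []; constructor; assumption. Qed.

(** Both systems share their rules, so comparing theorems reduces to deriving the axioms of each in
    the other. *)
Lemma provable_subsystem (Ax Ax' : formula -> Prop) :
  (forall A, Ax A -> provable Ax' A) ->
  forall A, provable Ax A -> provable Ax' A.
Proof.
intros sub A; induction 1.
- apply sub; assumption.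
- eapply pr_MP; eassumption.
- apply pr_RH; assumption.
- apply pr_RG; assumption.
Qed.

Theorem proposition5p3 (A : formula) :
  provable IKt_axiom A <-> provable IKt_reduced_axiom A.
Proof.
split; apply provable_subsystem.
- exact reduced_proves_IKt_axiom.
- intros B HB; apply pr_ax, reduced_axiom_IKt, HB.
Qed.
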